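(* Let $G$ be a finite abelian group. Then \[ \mu(G)=\begin{cases}\infty, & |G|\le 8\ \text{ or }\ G\cong C_3^2,\\ 6, & \text{otherwise.}\end{cases} \]
   Context: Groups are written additively; $C_m$ denotes the cyclic group of order $m$, and $C_3^2=C_3\oplus C_3$. For a finite subset $S$ of an abelian group $G$, write $\sigma(S)=\sum_{s\in S}s\in G$. A zero-sum triple partition of $S$ is a decomposition $S=T_1\sqcup\cdots\sqcup T_m$ ($m\ge 0$) into pairwise disjoint subsets with $|T_i|=3$ and $\sigma(T_i)=0$ for every $i$ (for $m=0$ this is the empty partition of the empty set). A finite subset $S\subseteq G$ is admissible if $3\mid |S|$ and $\sigma(S)=0$; it is partitionable if it has a zero-sum triple partition, and non-partitionable otherwise. For a finite abelian group $G$, $\mu(G)$ is the least cardinality of a non-partitionable admissible subset of $G$, with $\mu(G)=\infty$ if no such subset exists. *)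

(* Defs.v *)
From HB Require Import structures.
From mathcomp Require Import all_boot all_order all_fingroup all_algebra.

Set Implicit Arguments.
Unset Strict Implicit.
Unset Printing Implicit Defensive.

Import GRing.Theory.
Local Open Scope ring_scope.

Definition zmod_isomorphic (G H : zmodType) : Prop :=
  exists f : {additive G -> H}, bijective f.

Section ZeroSumTriples.

Variable G : finZmodType.
Implicit Types (S T : {set G}) (P : {set {set G}}).

Definition sigma S : G := \sum_(x in S) x.

Definition zero_sum_triple_partition P S : bool :=
  partition P S && [forall T in P, (#|T| == 3) && (sigma T == 0)].

Definition admissible S : bool := (3 %| #|S|)%N && (sigma S == 0).

Definition partitionable S : bool :=
  [exists P : {set {set G}}, zero_sum_triple_partition P S].

Definition obstruction S : bool := admissible S && ~~ partitionable S.

(* The least cardinality of an obstruction, in the extended naturals:         *)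
(* [None] stands for infinity.                                                *)
Definition mu : option nat :=
  if [pick S | obstruction S] is Some S0
  then Some #|[arg min_(S < S0 | obstruction S) #|S|]%N|
  else None.

Lemma mu_NoneP : mu = None <-> forall S, ~~ obstruction S.
Proof.
rewrite /mu; case: pickP => [S0 bS0|b0]; split=> //.
- by move/(_ S0); rewrite bS0.
- by move=> _ S; rewrite b0.
Qed.

Lemma mu_SomeP n : mu = Some n <->
  (exists2 S, obstruction S & #|S| = n) /\
  (forall S, obstruction S -> (n <= #|S|)%N).
Proof.
rewrite /mu; case: pickP => [S0 bS0|b0]; last first.
  by split=> // -[[S]]; rewrite b0.
case: arg_minnP => // S1 bS1 minS1; split=> [[<-]|[[S bS <-] minS]].
  by split=> //; exists S1.
by congr Some; apply/eqP; rewrite eqn_leq minS1 // minS.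
Qed.

End ZeroSumTriples.

(* Main.v *)
(* A zero-sum set of size 6 is partitionable as soon as it contains a zero-   *)
(* sum triple, and smaller admissible sets are trivially partitionable.       *)
(*                                                                            *)
(* If |G| <= 8, or |G| = 9 and 3G = 0, then every S with |S| >= 6 contains a  *)
(* zero-sum triple: at most |S| (|G| - |S|) pairs (x, y) in S x S have        *)
(* - x - y outside S, and at most 3 |S| pairs (only |S| if 3G = 0) make x, y, *)
(* - x - y not distinct. Splitting off triples then partitions S.             *)
(*                                                                            *)
(* Otherwise a set {a, -a, b, -b, c, -c} of size 6 without zero-sum triple is *)
(* an obstruction. If some x has order at least 5, take a = x, b = 2x and c   *)
(* outside {-3x, ..., 3x}. If there is no such x, then 3G = 0 or 4G = 0. When *)
(* 3G = 0 take a, b, c independent. When 4G = 0 but 2G != 0, take c = a + 2b  *)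
(* if 2a, 2b, 0 are distinct for some a, b; otherwise b = a + h, c = a + k    *)
(* for involutions h, k independent modulo <a>. When 2G = 0 the obstruction   *)
(* is {0, a, b, c, d, a + b + c + d} instead, with a, b, c, d independent.    *)

Require Import Defs.
From HB Require Import structures.
From mathcomp Require Import all_boot all_order all_fingroup all_algebra.

Set Implicit Arguments.
Unset Strict Implicit.
Unset Printing Implicit Defensive.

Import GRing.Theory.
Local Open Scope ring_scope.

(** Admissible sets with fewer than 6 elements are empty or a single zero-sum triple, so everything
    turns on whether larger sets must contain a zero-sum triple. In the exceptional groups a
    pigeonhole count over pairs ([has_zero_sum_triple_count]) forces one, and
    [admissible_partitionable] removes triples inductively. In every other group
    [obstruction_exists] splits by the orders of elements and finds a triple-free zero-sum 6-set,
    usually through [symmetric_obstruction]. C_3^2 enters only as a group of order 9 and exponent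
    3. *)

(** * Linear identities in abelian groups, by reflection *)

Inductive zmod_expr : Type :=
  | ZVar of nat
  | ZZero
  | ZAdd of zmod_expr & zmod_expr
  | ZOpp of zmod_expr
  | ZMuln of zmod_expr & nat.

Fixpoint zmod_eval (G : zmodType) (env : seq G) (e : zmod_expr) : G :=
  match e with
  | ZVar i => nth 0 env i
  | ZZero => 0
  | ZAdd e1 e2 => zmod_eval env e1 + zmod_eval env e2
  | ZOpp e1 => - zmod_eval env e1
  | ZMuln e1 n => zmod_eval env e1 *+ n
  end.

Fixpoint zmod_coef (e : zmod_expr) (i : nat) : int :=
  match e with
  | ZVar j => (j == i)%:Z
  | ZZero => 0
  | ZAdd e1 e2 => zmod_coef e1 i + zmod_coef e2 i
  | ZOpp e1 => - zmod_coef e1 i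
  | ZMuln e1 n => zmod_coef e1 i * n%:Z
  end.

Lemma zmod_evalE (G : zmodType) (env : seq G) (e : zmod_expr) :
  zmod_eval env e = \sum_(i < size env) nth 0 env i *~ zmod_coef e i.
Proof.
elim: e => [j||e1 IH1 e2 IH2|e IHe|e IHe n] /=.
- have [ltj|lej] := ltnP j (size env).
    rewrite (bigD1 (Ordinal ltj)) //= eqxx big1 ?addr0 // => i neq.
    by rewrite [j == i]eq_sym -[_ == j]/(i == Ordinal ltj) (negPf neq).
  rewrite nth_default // big1 // => i _.
  by rewrite gtn_eqF // (leq_trans (ltn_ord i)).
- by rewrite big1.
- by rewrite IH1 IH2 -big_split /=; apply: eq_bigr => i _; rewrite mulrzDr.
- by rewrite IHe -sumrN; apply: eq_bigr => i _; rewrite mulrNz.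
- by rewrite IHe -sumrMnl; apply: eq_bigr => i _; rewrite mulrzA -pmulrn.
Qed.

(** Both sides are integer combinations of the atoms in [env], so it suffices that coefficients
    agree modulo [N]. For N = 0 this means equal coefficients, which covers all abelian groups. *)
Lemma zmod_decide (G : zmodType) (N : nat) (env : seq G) (e1 e2 : zmod_expr) :
    (forall x : G, x *+ N = 0) ->
    all (fun i => N %| absz (zmod_coef e1 i - zmod_coef e2 i))%N
      (iota 0 (size env)) ->
  zmod_eval env e1 = zmod_eval env e2.
Proof.
move=> tors /allP coefN; apply/eqP; rewrite -subr_eq0 !zmod_evalE -sumrB.
apply/eqP/big1 => i _; rewrite -mulrzBr.
have /coefN : (i : nat) \in iota 0 (size env) by rewrite mem_iota /=.
case/dvdnP=> k; case: (zmod_coef e1 i - zmod_coef e2 i) => n /= nE.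
  by rewrite nE -pmulrn mulrnA tors.
by rewrite NegzE nE mulrNz -pmulrn mulrnA tors oppr0.
Qed.

Lemma neq_of_subr (G : zmodType) (x y u v : G) :
  x != y -> u - v = x - y -> u != v.
Proof. by rewrite -subr_eq0 => nz uvE; rewrite -subr_eq0 uvE. Qed.

Ltac zmod_atom_index x env :=
  lazymatch env with
  | x :: _ => constr:(0%N)
  | _ :: ?env' => let i := zmod_atom_index x env' in constr:(S i)
  end.

Ltac zmod_atoms env t :=
  lazymatch t with
  | ?x + ?y => let env' := zmod_atoms env x in zmod_atoms env' y
  | - ?x => zmod_atoms env x
  | ?x *+ _ => zmod_atoms env x
  | 0 => env
  | ?x =>
    match env with
    | context [x :: _] => env
    | _ => constr:(x :: env)
    end
  end.

Ltac zmod_reify env t :=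
  lazymatch t with
  | ?x + ?y =>
    let e1 := zmod_reify env x in
    let e2 := zmod_reify env y in constr:(ZAdd e1 e2)
  | - ?x => let e := zmod_reify env x in constr:(ZOpp e)
  | ?x *+ ?n => let e := zmod_reify env x in constr:(ZMuln e n)
  | 0 => constr:(ZZero)
  | ?x => let i := zmod_atom_index x env in constr:(ZVar i)
  end.

(* Proves an equation that holds in every abelian group of exponent dividing  *)
(* the [N] of [tors : forall x, x *+ N = 0].                                  *)
Ltac zmod_tors tors :=
  lazymatch goal with
  | |- @eq ?T ?l ?r =>
    let env0 := constr:(@nil T) in
    let env1 := zmod_atoms env0 l in
    let env := zmod_atoms env1 r in
    let e1 := zmod_reify env l in
    let e2 := zmod_reify env r in
    refine (@zmod_decide _ _ env e1 e2 tors _); vm_compute; reflexivity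
  end.

(* Proves a disequation that differs from a hypothesis by such an equation.   *)
Ltac zmod_neq_tors tors :=
  match goal with
  | H : is_true (_ != _) |- _ =>
    solve [ refine (neq_of_subr H _); zmod_tors tors
          | rewrite eq_sym; refine (neq_of_subr H _); zmod_tors tors ]
  end.

Ltac zmod_neq := zmod_neq_tors uconstr:(@mulr0n _).

(** * Triple-free zero-sum sets of size 6 *)

Section Obstructions.

Variable G : finZmodType.
Implicit Types (S T : {set G}) (a b c d x y z : G).

Lemma exists_notin (s : seq G) : (size s < #|G|)%N -> exists x, x \notin s.
Proof.
move=> lt_s; apply/existsP; apply: contraLR lt_s; rewrite -leqNgt.
rewrite negb_exists => /forallP all_s.
apply: leq_trans (card_size s); apply/subset_leq_card/subsetP=> x _.
by have := all_s x; rewrite negbK.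
Qed.

(** Any block of a partition would be a zero-sum triple. Triples are encoded as masks of [s], so
    that the 20 cases can be enumerated. *)
Lemma obstruction_of_seq (s : seq G) :
    uniq s -> size s = 6%N -> \sum_(x <- s) x = 0 ->
    (forall m : bitseq, size m = 6%N -> count id m = 3%N ->
      \sum_(x <- mask m s) x != 0) ->
  exists2 S : {set G}, obstruction S & #|S| = 6%N.
Proof.
move=> uniq_s size_s sum_s no_triple.
have card_s : #|[set x in s]| = 6%N by rewrite cardsE (card_uniqP uniq_s).
exists [set x in s] => //; apply/andP; split.
  rewrite /admissible card_s /=; apply/eqP.
  rewrite -[RHS]sum_s [RHS]big_uniq //.
  by apply: eq_bigl => x; rewrite inE.
apply/existsP => -[P /andP[partP /forall_inP tripleP]].
have /set0Pn[T PT] : P != set0.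
  apply: contra_eq_neq card_s => P0.
  by rewrite -(cover_partition partP) P0 /cover big_set0 cards0.
have /andP[/eqP card_T' /eqP sum_T] := tripleP T PT.
have card_T : #|T| = 3%N := card_T'.
have sTs : T \subset [set x in s] by exact: partitionS PT.
have maskE : mask [seq x \in T | x <- s] s = [seq x <- s | x \in T].
  by rewrite filter_mask.
have Tperm : perm_eq (enum T) [seq x <- s | x \in T].
  apply: uniq_perm; rewrite ?enum_uniq ?filter_uniq // => x.
  rewrite mem_enum mem_filter; case: (boolP (x \in T)) => //= /(subsetP sTs).
  by rewrite inE => ->.
have count_T : count id [seq x \in T | x <- s] = 3%N.
  by rewrite count_map -card_T cardE (perm_size Tperm) size_filter.
have /eqP := no_triple _ (etrans (size_map _ _) size_s) count_T; apply.
by rewrite maskE -(perm_big _ Tperm) big_enum.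
Qed.

(** In {a, -a, b, -b, c, -c} a triple containing some u and -u sums to its third element, which is
    nonzero. The other eight triples have sums ±a ± b ± c, and the last four hypotheses exclude
    these up to sign. *)
Lemma symmetric_obstruction a b c :
    a *+ 2 != 0 -> b *+ 2 != 0 -> c *+ 2 != 0 ->
    a != b -> a != - b -> a != c -> a != - c -> b != c -> b != - c ->
    a + b + c != 0 -> a + b != c -> a + c != b -> b + c != a ->
  exists2 S : {set G}, obstruction S & #|S| = 6%N.
Proof.
move=> a2 b2 c2 ab abN ac acN bc bcN abc abcN acbN bcaN.
have nz x : x *+ 2 != 0 -> x != 0 by apply: contraNneq => ->; rewrite mul0rn.
have [[a0 b0] c0] := (nz a a2, nz b b2, nz c c2).
apply: (@obstruction_of_seq [:: a; - a; b; - b; c; - c]) => //.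
- by rewrite /= !inE !negb_or !andbT; repeat (apply/andP; split); zmod_neq.
- by rewrite !big_cons big_nil; zmod_tors (@mulr0n G).
move=> [|[] [|[] [|[] [|[] [|[] [|[] []]]]]]] //= _ _;
  by rewrite !big_cons big_nil; zmod_neq.
Qed.

Lemma order_gt4_obstruction x :
    (8 < #|G|)%N -> x *+ 2 != 0 -> x *+ 3 != 0 -> x *+ 4 != 0 ->
  exists2 S : {set G}, obstruction S & #|S| = 6%N.
Proof.
move=> cardG x2 x3 x4.
have x0 : x != 0 by apply: contraNneq x2 => ->; rewrite mul0rn.
(* If h turns out to have 2h = 0, it is replaced by h + x, whose double is 2x. Excluding -4x keeps h
   + x away from -3x. *)
have [h] := @exists_notin
  [:: 0; x; - x; x *+ 2; - (x *+ 2); x *+ 3; - (x *+ 3); - (x *+ 4)] cardG.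
rewrite !inE !negb_or.
case/and5P=> h0 h1 hN1 h2 /and4P[hN2 h3 hN3 hN4].
have [h2_0|h2_0] := eqVneq (h *+ 2) 0.
  have hx2 : (h + x) *+ 2 != 0 by rewrite mulrnDl h2_0 add0r.
  by apply: (@symmetric_obstruction x (x *+ 2) (h + x)); zmod_neq.
by apply: (@symmetric_obstruction x (x *+ 2) h); zmod_neq.
Qed.

Lemma exponent3_obstruction :
    (9 < #|G|)%N -> (forall x, x *+ 3 = 0) ->
  exists2 S : {set G}, obstruction S & #|S| = 6%N.
Proof.
move=> cardG tors.
have [|a] := @exists_notin [:: 0]; first exact: leq_trans cardG.
rewrite inE => a0.
have [|b] := @exists_notin [:: 0; a; - a]; first exact: leq_trans cardG.
rewrite !inE !negb_or => /and3P[b0 ba bNa].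
have [c] := @exists_notin
  [:: 0; a; - a; b; - b; a + b; - a - b; a - b; b - a] cardG.
rewrite !inE !negb_or => /and5P[c0 ca cNa cb /and5P[cNb cab cNab caNb cbNa]].
by apply: (@symmetric_obstruction a b c); zmod_neq_tors tors.
Qed.

Lemma exponent2_obstruction :
    (8 < #|G|)%N -> (forall x, x *+ 2 = 0) ->
  exists2 S : {set G}, obstruction S & #|S| = 6%N.
Proof.
move=> cardG tors.
have [|a] := @exists_notin [:: 0]; first exact: leq_trans cardG.
rewrite inE => a0.
have [|b] := @exists_notin [:: 0; a]; first exact: leq_trans cardG.
rewrite !inE !negb_or => /andP[b0 ba].
have [|c] := @exists_notin [:: 0; a; b; a + b]; first exact: leq_trans cardG.
rewrite !inE !negb_or => /and4P[c0 ca cb cab].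
have [d] := @exists_notin
  [:: 0; a; b; a + b; c; a + c; b + c; a + b + c] cardG.
rewrite !inE !negb_or => /and5P[d0 da db dab /and4P[dc dac dbc dabc]].
(* Here x = -x, so the symmetric sets collapse. The only relation among a, b, c, d and their sum
   involves all five, so no triple sums to 0. *)
apply: (@obstruction_of_seq [:: 0; a; b; c; d; a + b + c + d]) => //.
- by rewrite /= !inE !negb_or !andbT; repeat (apply/andP; split);
    zmod_neq_tors tors.
- by rewrite !big_cons big_nil; zmod_tors tors.
move=> [|[] [|[] [|[] [|[] [|[] [|[] []]]]]]] //= _ _;
  by rewrite !big_cons big_nil; zmod_neq_tors tors.
Qed.

Lemma exponent4_obstruction :
    (8 < #|G|)%N -> (forall x, x *+ 4 = 0) ->
  exists2 S : {set G}, obstruction S & #|S| = 6%N.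
Proof.
move=> cardG tors.
have [/forallP tors2|] := boolP [forall x : G, x *+ 2 == 0].
  by apply: exponent2_obstruction => // x; apply/eqP.
rewrite negb_forall => /existsP[a a2].
have a0 : a != 0 by apply: contraNneq a2 => ->; rewrite mul0rn.
have neq2 x y : x *+ 2 != y *+ 2 -> x != y by apply: contraNneq => ->.
have [/existsP[b /andP[b2 ba2]]|] :=
    boolP [exists b : G, (b *+ 2 != 0) && (b *+ 2 != a *+ 2)].
  apply: (@symmetric_obstruction a b (a + b *+ 2));
    first [zmod_neq_tors tors | apply: neq2; zmod_neq_tors tors].
rewrite negb_exists => /forallP double_a.
(* Doubling only takes the values 0 and 2a, so outside any subgroup           *)
(* containing a there is an involution: x or x + a.                           *)
have invol x : (x *+ 2 == 0) || ((x + a) *+ 2 == 0).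
  have := double_a x; rewrite negb_and !negbK => /orP[->//|/eqP xa].
  by rewrite mulrnDl xa -mulrnDr tors eqxx orbT.
have [h] : exists2 h, h *+ 2 = 0 & h \notin [:: 0; a; a *+ 2; - a].
  have [|h] := @exists_notin [:: 0; a; a *+ 2; - a].
    exact: leq_trans cardG.
  rewrite !inE !negb_or => /and4P[h0 h1 h2 h3].
  have /orP[/eqP hE|/eqP hE] := invol h.
    by exists h; rewrite // !inE !negb_or h0 h1 h2.
  exists (h + a) => //; rewrite !inE !negb_or.
  by repeat (apply/andP; split); zmod_neq_tors tors.
rewrite !inE !negb_or => h2 /and4P[h0 ha h2a hNa].
have [k] : exists2 k, k *+ 2 = 0 &
    k \notin [:: 0; a; a *+ 2; - a; h; h + a; h + a *+ 2; h - a].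
  have [k] := @exists_notin
    [:: 0; a; a *+ 2; - a; h; h + a; h + a *+ 2; h - a] cardG.
  rewrite !inE !negb_or => /and5P[k0 k1 k2 k3 /and4P[k4 k5 k6 k7]].
  have /orP[/eqP kE|/eqP kE] := invol k.
    by exists k; rewrite // !inE !negb_or k0 k1 k2 k3 k4 k5 k6.
  exists (k + a) => //; rewrite !inE !negb_or.
  by repeat (apply/andP; split); zmod_neq_tors tors.
rewrite !inE !negb_or => k2 /and5P[k0 ka k2a kNa /and4P[kh kha kh2a khNa]].
(* The condition a + h != -(a + k) says 2a + h + k != 0. It is restated with -h because the tactic
   uses only 4G = 0, not 2h = 0. *)
have hN : - h = h by apply/eqP; rewrite eqr_oppLR -addr_eq0 -mulr2n h2.
have khN : k != - h + a *+ 2 by rewrite hN.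
by apply: (@symmetric_obstruction a (a + h) (a + k));
  first [ zmod_neq_tors tors
        | apply: neq2; rewrite ?mulrnDl h2 ?k2; zmod_neq_tors tors
        | apply: neq2; rewrite ?mulrnDl k2; zmod_neq_tors tors
        | rewrite ?mulrnDl ?h2 ?k2; zmod_neq_tors tors ].
Qed.

End Obstructions.

(** * Forced zero-sum triples and inductive partitioning *)

Section Partitions.

Variable G : finZmodType.
Implicit Types (S T : {set G}) (x y z : G).

Definition has_zero_sum_triple S : Prop :=
  exists T : {set G}, [/\ T \subset S, #|T| = 3%N & sigma T = 0].

Lemma partitionable_setU T S :
    #|T| = 3%N -> sigma T = 0 -> [disjoint T & S] -> partitionable S ->
  partitionable (T :|: S).
Proof.
move=> card_T sum_T disjTS /existsP[P /andP[partP /forall_inP tripleP]].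
apply/existsP; exists (T |: P); apply/andP; split.
  by apply: partitionU1 => //; rewrite -card_gt0 card_T.
apply/forall_inP => U /setU1P[->|/tripleP//].
by rewrite card_T sum_T !eqxx.
Qed.

Lemma partitionable0 : partitionable (set0 : {set G}).
Proof.
apply/existsP; exists set0; rewrite /zero_sum_triple_partition partition_set0.
by rewrite eqxx; apply/forall_inP => T; rewrite inE.
Qed.

Lemma admissible_partitionable :
    (forall S, (5 < #|S|)%N -> has_zero_sum_triple S) ->
  forall S, admissible S -> partitionable S.
Proof.
move=> triples S; have [n] := ubnP #|S|; elim: n S => // n IHn S ltSn admS.
have /andP[dvd3S /eqP sumS] := admS.
have [->|S0] := eqVneq S set0; first exact: partitionable0.
have [T [sTS card_T sum_T]] : has_zero_sum_triple S.
  (* A nonempty admissible set below size 6 has exactly three elements and is itself the triple. *)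
  have [/triples//|lt6] := ltnP 5 #|S|; exists S; split=> //.
  by move: dvd3S lt6 S0; rewrite -card_gt0; case: #|S| => [|[|[|[|[|[|?]]]]]].
have le3 : (3 <= #|S|)%N by rewrite -card_T subset_leq_card.
have card_D : #|S :\: T| = (#|S| - 3)%N.
  by rewrite cardsD (setIidPr sTS) card_T.
rewrite -(setID S T) (setIidPr sTS); apply: partitionable_setU => //.
  by rewrite disjoint_sym disjoints_subset subsetDr.
apply: IHn.
  by rewrite card_D ltn_subLR // (leq_trans ltSn) // -addn1 addnC leq_add2r.
rewrite /admissible card_D dvdn_subl // dvd3S.
move: sumS; rewrite /sigma (big_setID T) /= (setIidPr sTS).
by rewrite -[X in X + _]/(sigma T) sum_T add0r => ->; rewrite eqxx.
Qed.

(** [D] collects the degenerate pairs. For fixed x the map z -> -x - z is an involution, so the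
    pairs with third element outside [S] are the image [B] of S times its complement. The bound
    leaves a pair in neither set. *)
Lemma has_zero_sum_triple_count S (D : {set G * G}) :
    {in S &, forall x y, (x, y) \notin D ->
      [&& x != y, x != - x - y & y != - x - y]} ->
    (#|D| + #|S| * (#|G| - #|S|) < #|S| * #|S|)%N ->
  has_zero_sum_triple S.
Proof.
move=> distinct ltD.
pose B := [set (p.1, - p.1 - p.2) | p in setX S (~: S)].
have /subsetPn[[x y]] : ~~ (setX S S \subset D :|: B).
  apply: contraL ltD => /subset_leq_card; rewrite cardsX -leqNgt => leSS.
  apply: leq_trans leSS (leq_trans (leq_card_setU _ _) _).
  rewrite leq_add2l (leq_trans (leq_imset_card _ _)) // cardsX leq_mul2l.
  by rewrite [#|~: S|]cardsCs setCK leqnn orbT.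
rewrite !inE /= negb_or => /andP[Sx Sy] /andP[nD nB].
have /and3P[xy xz yz] := distinct x y Sx Sy nD.
have Sz : - x - y \in S.
  apply: contraR nB => Sz; apply/imsetP; exists (x, - x - y) => /=.
    by rewrite !inE Sx.
  by congr pair; zmod_tors (@mulr0n G).
exists (x |: (y |: [set - x - y])); split.
- by apply/subsetP => u; rewrite !inE => /or3P[] /eqP->.
- by rewrite !cardsU1 cards1 !inE negb_or xy xz yz.
rewrite /sigma !big_setU1 ?inE ?negb_or ?xy // big_set1 /=.
by zmod_tors (@mulr0n G).
Qed.

Lemma has_zero_sum_triple_le8 S :
  (#|G| <= 8)%N -> (5 < #|S|)%N -> has_zero_sum_triple S.
Proof.
move=> cardG ge6.
(* With z = -x - y, the three families are y = x, z = x and z = y. *)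
pose D := [set (x, x) | x in S] :|: [set (x, - (x *+ 2)) | x in S]
          :|: [set (- (x *+ 2), x) | x in S].
apply: (@has_zero_sum_triple_count S D) => [x y Sx Sy|].
  rewrite !inE !negb_or -!andbA => /and3P[n1 n2 n3].
  have xy : x != y by apply: contraNneq n1 => <-; apply: imset_f.
  have y2x : y != - (x *+ 2) by apply: contraNneq n2 => ->; apply: imset_f.
  have x2y : x != - (y *+ 2).
    by apply: contraNneq n3 => ->; apply/imsetP; exists y.
  by apply/and3P; split=> //; zmod_neq.
have leD : (#|D| <= #|S| * 3)%N.
  rewrite !mulnS muln0 addn0 addnA.
  apply: leq_trans (leq_card_setU _ _) (leq_add _ (leq_imset_card _ _)).
  apply: leq_trans (leq_card_setU _ _) (leq_add _ (leq_imset_card _ _)).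
  exact: leq_imset_card.
apply: leq_ltn_trans (leq_add leD (leqnn _)) _.
rewrite -mulnDr ltn_pmul2l; last exact: leq_trans ge6.
(* After cancelling |S|: 3 + (|G| - |S|) <= 3 + 2 < 6 <= |S|. *)
apply: leq_trans _ (ge6); rewrite ltnS (@leq_add2l 3 _ 2).
exact: leq_sub cardG ge6.
Qed.

Lemma has_zero_sum_triple_exponent3 S :
    (#|G| <= 9)%N -> (forall x, x *+ 3 = 0) -> (5 < #|S|)%N ->
  has_zero_sum_triple S.
Proof.
(* Since -2x = x, the three degenerate families coincide. *)
move=> cardG tors ge6; pose D := [set (x, x) | x in S].
apply: (@has_zero_sum_triple_count S D) => [x y Sx Sy nD|].
  have xy : x != y by apply: contraNneq nD => <-; apply: imset_f.
  by apply/and3P; split=> //; zmod_neq_tors tors.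
have leD : (#|D| <= #|S| * 1)%N by rewrite muln1 leq_imset_card.
apply: leq_ltn_trans (leq_add leD (leqnn _)) _.
rewrite -mulnDr ltn_pmul2l; last exact: leq_trans ge6.
apply: leq_trans _ (ge6); rewrite ltnS (@leq_add2l 1 _ 4).
exact: leq_trans (leq_sub cardG ge6) _.
Qed.

End Partitions.

(** * Recognising C_3^2 *)

Section Exponent3.

Variable G : finZmodType.
Hypothesis tors : forall x : G, x *+ 3 = 0.

Lemma mulrn_mod3 (x : G) n : x *+ (n %% 3) = x *+ n.
Proof.
by rewrite [in RHS](divn_eq n 3) mulrnDr mulnC mulrnA tors mul0rn add0r.
Qed.

(** Elements a != 0 and b outside {0, a, -a} form a basis: (i, j) -> ia + jb has trivial kernel,
    checked on the nine pairs, and is bijective by cardinality. *)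
Lemma isomorphic_Z3xZ3 :
  #|G| = 9%N -> zmod_isomorphic G ('Z_3 * 'Z_3)%type.
Proof.
move=> cardG.
have [|a] := @exists_notin G [:: 0]; first by rewrite cardG.
rewrite inE => a0.
have [|b] := @exists_notin G [:: 0; a; - a]; first by rewrite cardG.
rewrite !inE !negb_or => /and3P[b0 ba bNa].
pose phi (p : 'Z_3 * 'Z_3) : G := a *+ (p.1 : nat) + b *+ (p.2 : nat).
have phiD p q : phi (p + q) = phi p + phi q.
  by rewrite /phi /= !mulrn_mod3 !mulrnDr addrACA.
have phiB p q : phi (p - q) = phi p - phi q.
  by apply/eqP; rewrite eq_sym subr_eq -phiD subrK.
have phi_ker p : phi p = 0 -> p = 0.
  have neq0 (u : G) : u != 0 -> u = 0 -> p = 0 by move=> /eqP.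
  case: p neq0 => [[[|[|[|i]]] //= ?] [[|[|[|j]]] //= ?]] neq0;
    rewrite /phi /=;
    first [by move=> _; congr pair; apply: val_inj
          | by apply: neq0; zmod_neq_tors tors].
have phi_inj : injective phi.
  move=> p q /eqP; rewrite -subr_eq0 -phiB => /eqP/phi_ker/eqP.
  by rewrite subr_eq0 => /eqP.
have [|psi phiK psiK] := inj_card_bij phi_inj.
  by rewrite cardG card_prod !card_ord.
have psiB : zmod_morphism psi.
  by move=> x y; apply: phi_inj; rewrite phiB !psiK.
pose psi_additive := GRing.isZmodMorphism.Build _ _ psi psiB.
pose f : {additive G -> ('Z_3 * 'Z_3)%type} := HB.pack psi psi_additive.
by exists f; exists phi.
Qed.

End Exponent3.

Lemma isomorphic_exponent3 (G : finZmodType) :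
  zmod_isomorphic G ('Z_3 * 'Z_3)%type ->
  #|G| = 9%N /\ forall x : G, x *+ 3 = 0.
Proof.
case=> f bij_f; split.
  by rewrite (bij_eq_card bij_f) card_prod !card_ord.
move=> x; apply: (bij_inj bij_f); rewrite raddfMn raddf0.
case: (f x) => [[[|[|[|i]]] //= ?] [[|[|[|j]]] //= ?]]; congr pair;
  exact: val_inj.
Qed.

(** * The dichotomy between the exceptional groups and the rest *)

Lemma obstruction_ge6 (G : finZmodType) (S : {set G}) :
  obstruction S -> (5 < #|S|)%N.
Proof.
case/andP=> admS; rewrite ltnNge; apply: contra => lt6.
have /andP[dvd3S /eqP sumS] := admS.
have [->|S0] := eqVneq S set0; first exact: partitionable0.
rewrite -[S]setU0; apply: partitionable_setU => //.
- by move: dvd3S lt6 S0; rewrite -card_gt0; case: #|S| => [|[|[|[|[|[|?]]]]]].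
- by rewrite -setI_eq0 setI0.
- exact: partitionable0.
Qed.

Lemma obstruction_exists (G : finZmodType) :
    (8 < #|G|)%N -> ~ zmod_isomorphic G ('Z_3 * 'Z_3)%type ->
  exists2 S : {set G}, obstruction S & #|S| = 6%N.
Proof.
move=> cardG notC3.
have [/existsP[x /and3P[]]|] :=
    boolP [exists x : G, [&& x *+ 2 != 0, x *+ 3 != 0 & x *+ 4 != 0]].
  exact: order_gt4_obstruction.
rewrite negb_exists => /forallP small.
have order x : x *+ 3 = 0 \/ x *+ 4 = 0 :> G.
  have := small x; rewrite !negb_and !negbK => /or3P[] /eqP xE; auto.
  by right; rewrite (mulrnA x 2 2) xE mul0rn.
have [/existsP[x /andP[x0 /eqP x3]]|] :=
    boolP [exists x : G, (x != 0) && (x *+ 3 == 0)]; last first.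
  rewrite negb_exists => /forallP no3; apply: exponent4_obstruction => // x.
  have [x3|//] := order x; have := no3 x.
  by rewrite x3 eqxx andbT negbK => /eqP ->; rewrite mul0rn.
(* Orders 3 and 4 do not mix: if 4y = 0, then 3(x + y) = 0 gives 3y = 0, while 4(x + y) = 0 gives x
   = 4x = 0, a contradiction. *)
have tors (y : G) : y *+ 3 = 0.
  have [//|y4] := order y.
  have [|xy4] := order (x + y); first by rewrite mulrnDl x3 add0r.
  case/eqP: x0; rewrite -(addr0 x) -[X in x + X]x3 -mulrS.
  by rewrite -xy4 mulrnDl y4 addr0.
have [gt9|le9] := ltnP 9 #|G|; first exact: exponent3_obstruction.
by case: notC3; apply: isomorphic_Z3xZ3 => //; apply/eqP; rewrite eqn_leq le9.
Qed.

Local Close Scope ring_scope.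

Theorem theorem1p1 (G : finZmodType) :
  ((#|G| <= 8)%N \/ zmod_isomorphic G ('Z_3 * 'Z_3)%type -> mu G = None) /\
  (~ ((#|G| <= 8)%N \/ zmod_isomorphic G ('Z_3 * 'Z_3)%type) -> mu G = Some 6).
Proof.
split=> [small|large].
  apply/mu_NoneP => S; rewrite /obstruction negb_and negbK -implybE.
  apply/implyP; apply: admissible_partitionable => {}S.
  case: small => [cardG|/isomorphic_exponent3[cardG tors]].
    exact: has_zero_sum_triple_le8.
  by apply: has_zero_sum_triple_exponent3 => //; rewrite cardG.
apply/mu_SomeP; split; last exact: obstruction_ge6.
apply: obstruction_exists => [|iso]; last by apply: large; right.
by rewrite ltnNge; apply/negP => cardG; apply: large; left.
Qed.
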